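(* For every integer $n\ge 0$ and all $x,t$, $$\sum_{r=0}^{\infty}\omega_{n,r}(x)\frac{t^{r}}{r!}=e^{t}\left[\varphi_{n}(xt)+t\sum_{k=0}^{n}S(n,k)\,P_{k-1}^{k}(t)\,x^{k}\right],$$ where $$P_{k}^{n}(x)=\sum_{j=0}^{k-1}\left(\prod_{m=0}^{k-j-1}(n-m)\right)\binom{k}{j}x^{j}.$$
   Context: $S(n,k)$ denotes the Stirling numbers of the second kind. The geometric polynomials are $\omega_{n,r}(x)=\sum_{k=0}^{n}S(n,k)\,(r)_k\,x^{k}$, where $(r)_k=r(r+1)\cdots(r+k-1)$, $(r)_0=1$ (so $\omega_{n,0}(x)=\delta_{n,0}$). The exponential polynomials are $\varphi_n(x)=\sum_{k=0}^{n}S(n,k)x^k$. Empty sums are $0$, so $P_{-1}^{0}=P_{0}^{1}=0$. *)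

(* Defs.v *)
(* MathComp / MathComp-Analysis; the complex numbers are [R[i]] for [R : realType]. *)
From HB Require Import structures.
From mathcomp Require Import all_boot all_order all_algebra.
From mathcomp Require Export complex.
From mathcomp Require Import all_classical all_reals all_analysis.

Set Implicit Arguments.
Unset Strict Implicit.
Unset Printing Implicit Defensive.

Import GRing.Theory Num.Theory.

Local Open Scope ring_scope.

(* Stirling number of the second kind: the number of set partitions of an
   [n]-element set into [k] blocks ([partition] requires the blocks to be
   nonempty, and [stirling2 0 0 = 1]). *)
Definition stirling2 (n k : nat) : nat :=
  #|[set P : {set {set 'I_n}} | finset.partition P [set: 'I_n]%SET & #|P| == k]|.

Definition rising (r k : nat) : nat := (\prod_(i < k) (r + i))%N.

Definition geometric_poly (K : comNzRingType) (n r : nat) : {poly K} :=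
  \sum_(k < n.+1) (stirling2 n k * rising r k)%:R *: 'X^k.

Definition exponential_poly (K : comNzRingType) (n : nat) : {poly K} :=
  \sum_(k < n.+1) (stirling2 n k)%:R *: 'X^k.

(* The polynomial P_k^n.  The lower index is an integer because P_{-1}^0
   occurs; for a negative lower index the sum over 0 <= j <= k - 1 is empty.
   The differences n - m are taken in [K], not truncated. *)
Definition P_poly (K : comNzRingType) (k : int) (n : nat) : {poly K} :=
  if k is Posz k' then
    \sum_(j < k')
      ((\prod_(m < k' - j) (n%:R - m%:R)) * 'C(k', j)%:R) *: 'X^j
  else 0.

Definition cexp (R : realType) (z : R[i]) : R[i] :=
  let: (a +i* b)%C := z in (expR a * cos b +i* (expR a * sin b))%C.

(* Main.v *)
Require Import Defs.
From mathcomp Require Import all_boot all_order all_algebra.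
From mathcomp Require Import complex.
From mathcomp Require Import all_classical all_reals all_analysis.
From mathcomp Require Import ring zify.

Import Order.TTheory GRing.Theory Num.Theory.
Import numFieldNormedType.Exports.

Local Open Scope classical_set_scope.
Local Open Scope ring_scope.

(** The series is linear in the numbers [S(n, k) x ^ k], so it suffices to sum
[(r)_k t ^ r / r!] over [r] for each fixed [k].  By the Chu-Vandermonde
identity, the rising factorial is a combination of falling factorials with
Lah numbers as coefficients ([rising_ffact]):
<<
  (r)_(k+1) = sum_(i <= k) C(k, i) ((k+1)! / (i+1)!) r (r-1) ... (r-i).
>>
A falling factorial cancels against [r!] and only shifts the exponential
series, so that the sum of [r (r-1) ... (r-j+1) t ^ r / r!] is [t ^ j e ^ t]
([cvg_ffact_exp_series]).  In the resulting polynomial in [t] the top term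
[t ^ (k+1)] of each [k] contributes to the exponential polynomial at [x t],
and the other terms are exactly [t P_k^(k+1)(t)] ([horner_P_poly]).

The analytic input is that the exponential series converges to [cexp] on the
whole complex plane ([cvg_exp_sum]).  For [z = a + i b], the partial sums at
[a] converge to the real exponential and those at [i b] to [cos b + i sin b].
The truncated product of these two series differs from the truncated series
at [z] by the terms of the square [i, j < N] that lie outside the triangle
[i + j < N].  The modulus of this defect is at most the defect at the moduli
[|a|] and [|b|], and the latter tends to [0] because the real exponential
turns sums into products. *)

(** * Rising factorials in terms of falling factorials *)

(** Chu-Vandermonde for [C(r + k, k + 1)], multiplied by [(k + 1)!].  The
coefficient [k.+1 ^_ (k - i)] is [(k + 1)! / (i + 1)!], in the form of the
product that occurs in [P_poly]. *)
Lemma rising_ffact (r k : nat) :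
  rising r k.+1 =
  (\sum_(i < k.+1) 'C(k, i) * k.+1 ^_ (k - i) * r ^_ i.+1)%N.
Proof.
have -> : rising r k.+1 = ('C(r + k, k.+1) * (k.+1)`!)%N.
  rewrite bin_ffact /rising; elim: k r => [|k IHk] r.
    by rewrite big_ord_recl big_ord0 muln1 !addn0 ffactn1.
  by rewrite big_ord_recr /= IHk mulnC addnS ffactnS /=.
rewrite -binomial.Vandermonde big_ord_recl subn0 (bin_small (ltnSn k)) muln0 add0n.
rewrite big_distrl /=; apply: eq_bigr => i _.
have lik : (i <= k)%N by rewrite -ltnS.
rewrite subSS bin_sub // -(bin_ffact r).
rewrite -(@ffact_fact k.+1 (k - i)); last by rewrite leqW ?leq_subr.
rewrite subSn ?leq_subr // subKn // [bump 0 i]/=; ring.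
Qed.

(** * The exponential series on the complex plane *)

Definition exp_sum {K : numFieldType} (z : K) (N : nat) : K :=
  \sum_(i < N) z ^+ i / i`!%:R.

(** A sum over the part of the square outside the triangle, rather than a
difference of products of partial sums: only in this form can its modulus be
bounded term by term. *)
Definition exp_sum_defect {K : numFieldType} (x y : K) (N : nat) : K :=
  \sum_(i < N) \sum_(j < N | (N <= i + j)%N)
     (x ^+ i / i`!%:R) * (y ^+ j / j`!%:R).

(** By the binomial theorem, [(x + y) ^ m / m!] is the sum of the products of
the terms of degrees [i] and [m - i]; for all [m < N] together these fill the
triangle [i + j < N] of the square of index pairs. *)
Lemma exp_sumD {K : numFieldType} (x y : K) (N : nat) :
  exp_sum (x + y) N = exp_sum x N * exp_sum y N - exp_sum_defect x y N.
Proof.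
pose F i j : K := (x ^+ i / i`!%:R) * (y ^+ j / j`!%:R).
have -> : exp_sum (x + y) N = \sum_(i < N) \sum_(j < N | (i + j < N)%N) F i j.
  (* Summation by degree [m]; the exchange below turns it into rows. *)
  transitivity (\sum_(0 <= m < N) \sum_(0 <= i < N | (i <= m)%N) F i (m - i)%N).
    rewrite big_mkord; apply: eq_bigr => m _.
    rewrite addrC exprDn mulr_suml big_mkord.
    rewrite (big_ord_widen N
      (fun i => (y ^+ (m - i) * x ^+ i) *+ 'C(m, i) / m`!%:R)) //.
    apply: eq_bigr => i; rewrite ltnS => lim.
    rewrite -mulr_natr -(bin_fact lim) !natrM /F.
    field.
    by rewrite !pnatr_eq0 -!lt0n !fact_gt0 bin_gt0 lim.
  rewrite (@exchange_big_dep_nat _ _ _ _ _ _ _ _ _ predT) //= big_mkord.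
  apply: eq_bigr => i _.
  transitivity (\sum_(i <= m < N) F i (m - i)%N).
    by rewrite [RHS](big_nat_widenl i 0).
  rewrite -{1}[i : nat]add0n big_addn big_mkord.
  rewrite (big_ord_widen N (fun j => F i (j + i - i)%N)) ?leq_subr //.
  by apply: eq_big => [j|j _]; rewrite ?addnK // ltn_subRL.
rewrite /exp_sum big_distrlr /= /exp_sum_defect -sumrB.
apply: eq_bigr => i _; rewrite [in RHS](bigID (fun j : 'I_N => (i + j < N)%N)) /=.
rewrite [X in _ = _ + X - _](eq_bigl (fun j : 'I_N => N <= i + j)%N) ?addrK //.
by move=> j; rewrite -leqNgt.
Qed.

Lemma normr_exp_sum_defect {K : numFieldType} (x y : K) (N : nat) :
  `|exp_sum_defect x y N| <= exp_sum_defect `|x| `|y| N.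
Proof.
apply: le_trans (ler_norm_sum _ _ _) _; apply: ler_sum => i _.
apply: le_trans (ler_norm_sum _ _ _) _; apply: ler_sum => j _.
by rewrite !normrM !normrX !normfV !normr_nat.
Qed.

Lemma cvg_exp_sumR {R : realType} (x : R) : exp_sum x @ \oo --> expR x.
Proof.
have -> : exp_sum x = series (exp_coeff x).
  by apply/funext => N; rewrite /exp_sum /series /= big_mkord.
exact: is_cvg_series_exp_coeff.
Qed.

(** The defect is [exp_sum x N * exp_sum y N - exp_sum (x + y) N], whose limit
vanishes by the functional equation of the real exponential. *)
Lemma cvg_exp_sum_defectR {R : realType} (x y : R) :
  exp_sum_defect x y @ \oo --> 0.
Proof.
have -> : exp_sum_defect x y =
    fun N => exp_sum x N * exp_sum y N - exp_sum (x + y) N.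
  by apply/funext => N; rewrite exp_sumD subKr.
rewrite -(subrr (expR (x + y))) {1}expRD.
by apply: cvgB; [apply: cvgM|]; exact: cvg_exp_sumR.
Qed.

Lemma normc_le_ReDIm {R : rcfType} (x y : R) :
  `|(x +i* y)%C| <= (`|x| + `|y|)%:C%C :> R[i].
Proof.
have -> : (x +i* y)%C = x%:C%C + y%:C%C * 'i%C :> R[i] by simpc.
apply: le_trans (ler_normD _ _) _; rewrite normrM !normc_def /=.
by rewrite expr0n /= !addr0 add0r !sqrtr_sqr normr1 mulr1 rmorphD.
Qed.

Lemma cvg_complex {R : realType} (u v : R^nat) (a b : R) :
  u @ \oo --> a -> v @ \oo --> b ->
  ((fun N => (u N +i* v N)%C : R[i]^o) @ \oo --> ((a +i* b)%C : R[i]^o)).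
Proof.
move=> /cvgrPdist_lt ua /cvgrPdist_lt vb; apply/cvgrPdist_lt => -[e e'].
rewrite ltcE /= => /andP[/eqP -> e0].
have e2 : 0 < e / 2 by rewrite divr_gt0.
near=> N.
have h : `|((a - u N) +i* (b - v N))%C| < (e +i* 0)%C :> R[i].
  apply: le_lt_trans (normc_le_ReDIm _ _) _.
  by rewrite ltcE /= eqxx /= [e]splitr ltrD //; near: N; [exact: ua|exact: vb].
exact: h.
Unshelve. all: by end_near. Qed.

Lemma exp_sum_real {R : realType} (x : R) (N : nat) :
  exp_sum (x%:C%C : R[i]) N = (exp_sum x N)%:C%C.
Proof.
rewrite /exp_sum rmorph_sum; apply: eq_bigr => i _.
by rewrite rmorphM rmorphXn fmorphV rmorph_nat.
Qed.

Lemma exp_sum_defect_real {R : realType} (x y : R) (N : nat) :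
  exp_sum_defect (x%:C%C : R[i]) y%:C%C N = (exp_sum_defect x y N)%:C%C.
Proof.
have -> (K : numFieldType) (z w : K) :
    exp_sum_defect z w N = exp_sum z N * exp_sum w N - exp_sum (z + w) N.
  by rewrite exp_sumD subKr.
by rewrite -rmorphD !exp_sum_real -rmorphM -rmorphB exp_sumD subKr.
Qed.

Lemma expri {R : rcfType} (n : nat) :
  'i%C ^+ n =
  ((~~ odd n)%:R * (-1) ^+ n./2 +i* ((odd n)%:R * (-1) ^+ n.-1./2))%C :> R[i].
Proof.
elim: n => [|n IHn]; first by rewrite mul1r mul0r.
rewrite exprS {}IHn /= negbK; case: n => [|n] /=; simpc => //.
by congr (_ +i* _)%C; rewrite exprS mulrCA mulN1r.
Qed.

(** [sin_coeff] and [cos_coeff] are indexed by all degrees, with zeros at those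
of the wrong parity, so the identity holds term by term, without regrouping. *)
Lemma exp_sum_imaginary {R : realType} (y : R) (N : nat) :
  exp_sum ((0 +i* y)%C : R[i]) N =
  (series (cos_coeff y) N +i* series (sin_coeff y) N)%C.
Proof.
rewrite /exp_sum /series /= !big_mkord.
elim/big_rec3: _ => [//|i c s z _ ->].
have -> : (0 +i* y)%C = y%:C%C * 'i%C :> R[i] by simpc.
rewrite exprMn expri -rmorphXn -(rmorph_nat (real_complex R)) -fmorphV.
rewrite /real_complex_def /cos_coeff /sin_coeff /= !exprnP; simpc.
by rewrite ![y ^ i * (_ * _)]mulrC.
Qed.

(** Only the horizontal and vertical directions of the plane need to be
combined, and there the partial sums are known real sequences; this avoids
both the completeness of the complex numbers and a general theorem on Cauchy
products. *)
Lemma cvg_exp_sum {R : realType} (z : R[i]) :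
  (exp_sum z : R[i]^o^nat) @ \oo --> (cexp z : R[i]^o).
Proof.
case: z => a b.
have split_z : (a +i* b)%C = a%:C%C + (0 +i* b)%C :> R[i] by simpc.
have -> : exp_sum (a +i* b)%C = (fun N =>
    exp_sum (a%:C%C : R[i]) N * exp_sum ((0 +i* b)%C : R[i]) N
    - exp_sum_defect (a%:C%C : R[i]) (0 +i* b)%C N).
  by apply/funext => N; rewrite split_z exp_sumD.
have -> : cexp (a +i* b)%C = (expR a)%:C%C * (cos b +i* sin b)%C - 0 :> R[i].
  by rewrite subr0 /cexp; simpc.
have cvg_a : (exp_sum (a%:C%C : R[i]) : R[i]^o^nat) @ \oo -->
    ((expR a)%:C%C : R[i]^o).
  rewrite (_ : exp_sum _ = fun N => (exp_sum a N +i* 0)%C); last first.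
    by apply/funext => N; rewrite exp_sum_real.
  by apply: (@cvg_complex R); [exact: cvg_exp_sumR|exact: cvg_cst].
have cvg_b : (exp_sum ((0 +i* b)%C : R[i]) : R[i]^o^nat) @ \oo -->
    ((cos b +i* sin b)%C : R[i]^o).
  rewrite (_ : exp_sum _ =
    fun N => (series (cos_coeff b) N +i* series (sin_coeff b) N)%C); last first.
    by apply/funext => N; rewrite exp_sum_imaginary.
  apply: cvg_complex; rewrite unlock.
    exact: is_cvg_series_cos_coeff.
  exact: is_cvg_series_sin_coeff.
have cvg_d : (exp_sum_defect (a%:C%C : R[i]) (0 +i* b)%C : R[i]^o^nat) @ \oo -->
    (0 : R[i]^o).
  have := cvg_exp_sum_defectR `|a| `|b|.
  move=> /cvgrPdist_lt d0; apply/cvgrPdist_lt => -[e e'].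
  rewrite ltcE /= => /andP[/eqP -> e0]; near=> N.
  have h : `|0 - exp_sum_defect (a%:C%C : R[i]) (0 +i* b)%C N| < (e +i* 0)%C :> R[i].
    rewrite sub0r normrN; apply: le_lt_trans (normr_exp_sum_defect _ _ _) _.
    rewrite !normc_def /= expr0n addr0 add0r !sqrtr_sqr exp_sum_defect_real.
    rewrite ltcE /= eqxx /=; apply: le_lt_trans (ler_norm _) _.
    by rewrite -normrN -sub0r; near: N; exact: d0.
  exact: h.
exact: (cvgB (cvgM cvg_a cvg_b) cvg_d).
Unshelve. all: by end_near. Qed.

(** * Exponential generating functions of factorials *)

(** The terms with [r < j] vanish, and [(r + j) ^_ j / (r + j)! = 1 / r!]. *)
Lemma cvg_ffact_exp_series {R : realType} (j : nat) (t : R[i]) :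
  series (fun r : nat => (r ^_ j)%:R * (t ^+ r / r`!%:R) : R[i]^o) @ \oo -->
  (t ^+ j * cexp t : R[i]^o).
Proof.
rewrite -(cvg_shiftn j).
rewrite (_ : [sequence _]_n = fun N => t ^+ j * exp_sum t N); last first.
  apply/funext => N; rewrite /series /= (@big_cat_nat _ _ _ j) ?leq_addl //=.
  rewrite big_nat_cond big1 ?add0r; last first.
    by move=> r /andP[/andP[_ rj] _]; rewrite ffact_small // mul0r.
  rewrite -{1}[j]add0n big_addn addnK big_mkord /exp_sum mulr_sumr.
  apply: eq_bigr => r _.
  have := @ffact_fact (r + j) j (leq_addl _ _); rewrite addnK => <-.
  have ffact_neq0 : ((r + j) ^_ j)%:R != 0 :> R[i].
    by rewrite pnatr_eq0 -lt0n ffact_gt0 leq_addl.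
  rewrite natrM exprD; field.
  by rewrite ffact_neq0 pnatr_eq0 -lt0n fact_gt0.
by apply: cvgMr; exact: cvg_exp_sum.
Qed.

Lemma cvg_series_sum {R : realType} (n : nat) (f : 'I_n -> R[i]^nat)
    (l : 'I_n -> R[i]) :
  (forall k, series (f k : R[i]^o^nat) @ \oo --> (l k : R[i]^o)) ->
  series (fun r => \sum_(k < n) f k r : R[i]^o) @ \oo -->
  (\sum_(k < n) l k : R[i]^o).
Proof.
move=> fl.
rewrite (_ : series _ = fun N => \sum_(k < n) series (f k : R[i]^o^nat) N).
  by apply: cvg_big => [|k _]; [exact: add_continuous|exact: fl].
by apply/funext => N; rewrite /series /= exchange_big.
Qed.

Lemma cvg_seriesMl {R : realType} (c : R[i]) (f : R[i]^nat) (l : R[i]) :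
  series (f : R[i]^o^nat) @ \oo --> (l : R[i]^o) ->
  series (fun r => c * f r : R[i]^o) @ \oo --> (c * l : R[i]^o).
Proof.
move=> fl.
rewrite (_ : series _ = fun N => c * series (f : R[i]^o^nat) N).
  by apply: cvgMr.
by apply/funext => N; rewrite /series /= mulr_sumr.
Qed.

(** The summand [t ^ k.+1] is [t] times the missing index [j = k] in the
definition of [P_poly]: its coefficient, an empty product times [C(k, k)], is [1]. *)
Lemma horner_P_poly {K : comNzRingType} (k : nat) (t : K) :
  t ^+ k.+1 + t * (P_poly K (k.+1%:Z - 1) k.+1).[t] =
  \sum_(i < k.+1) ('C(k, i) * k.+1 ^_ (k - i))%:R * t ^+ i.+1.
Proof.
have -> : k.+1%:Z - 1 = k by rewrite -addn1 PoszD addrK.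
rewrite big_ord_recr /= binn subnn ffactn0 muln1 mul1r addrC; congr (_ + _).
rewrite horner_sum mulr_sumr; apply: eq_bigr => j _.
rewrite hornerZ hornerXn ffact_prod natrM natr_prod exprS.
rewrite [in RHS](eq_bigr (fun m : 'I_(k - j) => k.+1%:R - m%:R : K)); first by ring.
move=> m _; rewrite natrB //.
by have := ltn_ord m; lia.
Qed.

Lemma cvg_rising_exp_series {R : realType} (k : nat) (t : R[i]) :
  series (fun r : nat => (rising r k)%:R * (t ^+ r / r`!%:R) : R[i]^o) @ \oo -->
  (cexp t * (t ^+ k + t * (P_poly R[i] (k%:Z - 1) k).[t]) : R[i]^o).
Proof.
case: k => [|k].
  rewrite horner0 mulr0 addr0 mulrC.
  rewrite (_ : (fun r => _) = fun r => (r ^_ 0)%:R * (t ^+ r / r`!%:R)).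
    exact: cvg_ffact_exp_series.
  by apply/funext => r; rewrite /rising big_ord0 ffactn0.
rewrite horner_P_poly mulr_sumr.
rewrite (_ : (fun r => _) = fun r => \sum_(i < k.+1)
    ('C(k, i) * k.+1 ^_ (k - i))%:R * ((r ^_ i.+1)%:R * (t ^+ r / r`!%:R))).
  apply: cvg_series_sum => i; rewrite mulrCA [cexp t * _]mulrC.
  exact/cvg_seriesMl/cvg_ffact_exp_series.
apply/funext => r; rewrite rising_ffact natr_sum mulr_suml.
by apply: eq_bigr => i _; rewrite natrM -mulrA.
Qed.

Theorem proposition4 (R : realType) (n : nat) (x t : R[i]) :
  series (fun r : nat => (geometric_poly R[i] n r).[x] * (t ^+ r / r`!%:R)
            : R[i]^o) @ \oo -->
  (cexp t * ((exponential_poly R[i] n).[x * t] +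
     t * \sum_(k < n.+1)
           (stirling2 n k)%:R * (P_poly R[i] (k%:Z - 1) k).[t] * x ^+ k)
     : R[i]^o).
Proof.
rewrite (_ : cexp t * _ = \sum_(k < n.+1) ((stirling2 n k)%:R * x ^+ k) *
    (cexp t * (t ^+ k + t * (P_poly R[i] (k%:Z - 1) k).[t]))); last first.
  rewrite /exponential_poly horner_sum mulr_sumr -big_split mulr_sumr.
  apply: eq_bigr => k _; rewrite hornerZ hornerXn exprMn /=; ring.
rewrite (_ : (fun r => _) = fun r => \sum_(k < n.+1)
    ((stirling2 n k)%:R * x ^+ k) * ((rising r k)%:R * (t ^+ r / r`!%:R))).
  by apply: cvg_series_sum => k; exact/cvg_seriesMl/cvg_rising_exp_series.
apply/funext => r; rewrite /geometric_poly horner_sum mulr_suml.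
by apply: eq_bigr => k _; rewrite hornerZ hornerXn natrM; ring.
Qed.
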